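(* Let $r\geq 1$ be an integer and let $t=27720r+169$. Then for every integer $n\geq \frac{6911}{16}t^{2}+\frac{514441}{8}t-\frac{3309665}{16}$, we have $f(n)\geq n+32t-1$.
   Context: For a positive integer $n$, $f(n)$ denotes the maximum number of edges in a (simple, finite) graph on $n$ vertices in which no two distinct cycles have the same length. *)

(* Defs.v *)
From mathcomp Require Import all_boot.
Set Implicit Arguments. Unset Strict Implicit. Unset Printing Implicit Defensive.

Definition adj (n : nat) (g : {ffun 'I_n * 'I_n -> bool}) : rel 'I_n :=
  fun x y => g (x, y).

Definition simple_graph (n : nat) (g : {ffun 'I_n * 'I_n -> bool}) : bool :=
  [forall x, ~~ adj g x x] && [forall x, forall y, adj g x y == adj g y x].

Definition edges (n : nat) (g : {ffun 'I_n * 'I_n -> bool}) : {set {set 'I_n}} :=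
  [set E : {set 'I_n} | [exists x, exists y, (E == [set x; y]) && adj g x y]].

Definition nedges (n : nat) (g : {ffun 'I_n * 'I_n -> bool}) : nat := #|edges g|.

Definition is_cycle (n : nat) (g : {ffun 'I_n * 'I_n -> bool}) (s : seq 'I_n) : bool :=
  [&& 2 < size s, uniq s & cycle (adj g) s].

(* The cycle as a subgraph: its edge set. Two vertex sequences describe the
   same cycle iff they have the same edge set (rotations/reflections). *)
Definition cycle_edges (n : nat) (s : seq 'I_n) : {set {set 'I_n}} :=
  [set [set p.1; p.2] | p in zip s (rot 1 s)].

(* No two distinct cycles have the same length.  A cycle, being duplicate-free,
   has at most n vertices, so it suffices to range over k-tuples with k <= n
   (this keeps the predicate boolean). *)
Definition distinct_cycle_lengths (n : nat) (g : {ffun 'I_n * 'I_n -> bool}) : bool :=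
  [forall k : 'I_n.+1, forall s1 : k.-tuple 'I_n, forall s2 : k.-tuple 'I_n,
    (is_cycle g s1 && is_cycle g s2) ==> (cycle_edges s1 == cycle_edges s2)].

Definition admissible (n : nat) (g : {ffun 'I_n * 'I_n -> bool}) : bool :=
  simple_graph g && distinct_cycle_lengths g.

Definition f (n : nat) : nat :=
  \max_(g : {ffun 'I_n * 'I_n -> bool} | admissible g) nedges g.

(* Main.v *)
Require Import Defs.
From mathcomp Require Import all_boot zify.
Set Implicit Arguments. Unset Strict Implicit. Unset Printing Implicit Defensive.

(** The extremal graph is a bouquet of blocks glued at one apex [x].  Put
    [T = 2 tau], [tau = 18480 r + 113].  For each [c < T - 1] there is a fan: a
    path meeting [x] in ten subdivided spokes, of cyclomatic number 9, with one
    cycle for each pair [i < j] of spokes.  Lengthening every spoke by one when [c]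
    increases by one makes all cycle lengths grow by two, so the pair [(i, j)]
    contributes lengths of one parity in a window [B T, (B + 2) T).  The ten
    spokes are chosen so that windows of the same parity never overlap, the
    windows of consecutive spokes lie below [24 T], and all the others above it.
    Every length in [[3, 24 T)] that is not a cycle of consecutive spokes is
    realised by a single cycle through [x].  This gives [24 T - 3 >= 32 t]
    independent cycles on [970 tau ^ 2 + 19 tau] vertices besides [x]: a fan is
    cheaper than nine disjoint cycles, because the inner spokes are shared.

    Removing [x] leaves a forest of combs, so every cycle runs through [x] and is
    determined by the two neighbours of [x] on it. *)

(** * Edge sets of cycles under rotation and reversal *)

Lemma zip_rot (S T : Type) (k : nat) (s : seq S) (t : seq T) :
  size s = size t -> zip (rot k s) (rot k t) = rot k (zip s t).
Proof.
move=> eq_st; rewrite /rot zip_cat ?size_drop ?eq_st //.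
by congr (_ ++ _); elim: s t k eq_st => [|x s IHs] [|y t] [|k] //= [] /IHs ->.
Qed.

Lemma cycle_edges_rot (n k : nat) (s : seq 'I_n) :
  cycle_edges (rot k s) = cycle_edges s.
Proof.
rewrite /cycle_edges rot_rot zip_rot ?size_rot //.
by apply/setP => E; apply/imsetP/imsetP => -[p ps ->]; exists p; rewrite ?mem_rot // in ps *.
Qed.

Lemma mem_zip_swap (T : eqType) (s t : seq T) (p : T * T) :
  (p \in zip s t) = ((p.2, p.1) \in zip t s).
Proof.
case: p => z w; elim: s t => [|x s IHs] [|y t] //=.
by rewrite !inE IHs !xpair_eqE andbC.
Qed.

Lemma cycle_edges_rev (n : nat) (s : seq 'I_n) :
  cycle_edges (rev s) = cycle_edges s.
Proof.
(* Turned back by one place, [s] yields the same consecutive pairs as its reversal, with components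
   swapped. *)
rewrite -[RHS](cycle_edges_rot (size s - 1)) -/(rotr 1 s) /cycle_edges rotrK.
rewrite -rev_rotr -rev_zip ?size_rotr //.
apply/setP => F; apply/imsetP/imsetP => -[p ps ->]; exists (p.2, p.1) => /=.
- by rewrite mem_zip_swap -surjective_pairing; rewrite mem_rev in ps.
- exact: setUC.
- by rewrite mem_rev mem_zip_swap -surjective_pairing.
- exact: setUC.
Qed.

(** * Combs *)

(* Fan index, position on the spine, height on the tooth at that position.  The
   forest [par] is infinite; a finite part of it is selected later. *)
Definition coord : Type := (nat * nat * nat)%type.

Definition par (v : coord) : option coord :=
  let: (c, a, h) := v in
  if h is h'.+1 then Some (c, a, h')
  else if a is a'.+1 then Some (c, a', 0) else None.

Definition rk (v : coord) : nat := v.1.2 + v.2.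

Definition comb_adj : rel coord :=
  fun v w => (par v == Some w) || (par w == Some v).

(** Tree distance between two vertices of one fan. Each pair of opposite truncated subtractions adds
    up to an absolute difference. *)
Definition comb_dist (v w : coord) : nat :=
  let: (_, a, h) := v in let: (_, b, k) := w in
  if a == b then (h - k) + (k - h) else h + k + (a - b) + (b - a).

Lemma par_rk v w : par v = Some w -> rk v = (rk w).+1.
Proof.
case: v w => [[c a] h] [[c' a'] h'] /=.
by case: h => [|h]; [case: a => [|a] //|]; case=> *; subst; rewrite /rk /=; lia.
Qed.

Lemma comb_adj_sym : symmetric comb_adj.
Proof. by move=> v w; rewrite /comb_adj orbC. Qed.

Lemma comb_adj_down v w : comb_adj v w -> rk w <= rk v -> par v = Some w.
Proof. by case/orP => /eqP // /par_rk ->; rewrite ltnn. Qed.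

(** After a step up, the only way not to climb further is to return to the parent, which is the
    vertex just left. *)
Lemma comb_path_up y p : path comb_adj y p -> uniq (y :: p) ->
  (exists2 w, p = w :: behead p & par w = Some y) -> p != [::] /\ rk y < rk (last y p).
Proof.
elim: p y => [|w p IHp] y /=; first by move=> _ _ [].
case/andP=> yw wp /andP [yp up] [_ [<-] pw]; split=> //.
have rw := par_rk pw.
case: p IHp wp yp up => [|z p] IHp wp yp up; first by rewrite /= rw.
have [] := IHp w wp up; last by move=> _; rewrite rw => /ltnW.
exists z => //; move: wp => /= /andP[/orP[|/eqP//]]; rewrite pw => /eqP [yz].
by rewrite -yz !inE eqxx orbT in yp.
Qed.

Lemma comb_path_head y w p : path comb_adj y (w :: p) -> uniq (y :: w :: p) ->
  rk (last w p) <= rk y -> par y = Some w.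
Proof.
move=> yp up rl; move: (yp) => /= /andP[/orP[/eqP//|/eqP wy] _].
have [_ /=] := comb_path_up yp up (ex_intro2 _ _ w erefl wy).
by rewrite ltnNge rl.
Qed.

Lemma comb_path_last y z p : path comb_adj y (rcons p z) -> uniq (y :: rcons p z) ->
  rk y <= rk z -> par z = Some (last y p).
Proof.
move=> yp up ryz.
have := @comb_path_head z (last y p) (behead (rev (y :: p))).
have E : last y p :: behead (rev (y :: p)) = rev (y :: p).
  by case/lastP: p {yp up} => // p w; rewrite last_rcons -rcons_cons rev_rcons.
rewrite E; apply.
- have := rev_path comb_adj y (rcons p z); rewrite last_rcons belast_rcons => ->.
  by rewrite (eq_path (e' := comb_adj)) // => v w; rewrite comb_adj_sym.
- by rewrite -rev_rcons rev_uniq.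
- suff -> : last (last y p) (behead (rev (y :: p))) = y by [].
  by rewrite -[LHS]/(last y (_ :: behead _)) E rev_cons last_rcons.
Qed.

Lemma comb_dist_sym v w : comb_dist v w = comb_dist w v.
Proof.
case: v w => [[c a] h] [[c' b] k] /=; rewrite eq_sym; case: eqP => _; lia.
Qed.

(** A vertex other than [y] of no larger rank does not descend from [y], so the way to it starts at
    the parent. *)
Lemma comb_dist_par y w z : rk z <= rk y -> par y = Some w -> y.1.1 = z.1.1 -> y <> z ->
  comb_dist y z = (comb_dist w z).+1.
Proof.
case: y w z => [[c a] h] [[c' a'] h'] [[d b] k]; rewrite /rk /= => rzy.
case: h rzy => [|h] rzy; last first.
  case=> _ <- <- cd ne; case: eqP => [ab|ne']; last lia.
  suff: k <> h.+1 by lia.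
  by move=> kh; apply: ne; rewrite ab kh -[c]/((c, a, h).1.1) cd.
case: a rzy => [|a] rzy; first by [].
case=> _ <- <- cd ne.
have ne' : a.+1 = b -> k <> 0.
  by move=> ab k0; apply: ne; rewrite ab k0 -[c]/((c, a, 0).1.1) cd.
by case: eqP => [ab|nab]; case: eqP => [ab'|nab']; lia.
Qed.

Lemma par_fan y w : par y = Some w -> y.1.1 = w.1.1.
Proof. by case: y w => [[c [|a]] [|h]] [[c' a'] h'] //= []. Qed.

Lemma comb_adj_fan y w : comb_adj y w -> y.1.1 = w.1.1.
Proof. by case/orP => /eqP/par_fan. Qed.

Lemma comb_path_fan y p : path comb_adj y p -> y.1.1 = (last y p).1.1.
Proof. by elim: p y => //= w p IHp y /andP[/comb_adj_fan -> /IHp]. Qed.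

Lemma comb_dist_refl y : comb_dist y y = 0.
Proof. by case: y => [[c a] h] /=; rewrite eqxx subnn. Qed.

(** Induction that drops the end of larger rank: its neighbour on a simple path must be its parent,
    so the length and [comb_dist] decrease together. *)
Lemma comb_path_size y p : path comb_adj y p -> uniq (y :: p) ->
  size p = comb_dist y (last y p).
Proof.
have [m le_m] := ubnP (size p); elim: m y p le_m => // m IHm y p le_m yp up.
have [->|pn] := eqVneq p [::]; first by rewrite /= comb_dist_refl.
have [r|r] := leqP (rk (last y p)) (rk y).
  case: p pn le_m yp up r => // w p _ le_m yp up r.
  have pw := comb_path_head yp up r.
  rewrite (comb_dist_par r pw (comb_path_fan yp)) /=.
    by congr _.+1; apply: IHm => //; [case/andP: yp | case/andP: up].
  by move=> E; move: up => /=; rewrite {1}E /= mem_last.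
case/lastP: p pn le_m yp up r => // p z _ le_m yp up; rewrite last_rcons => r.
have pw := comb_path_last yp up (ltnW r).
have fan : z.1.1 = y.1.1 by rewrite (comb_path_fan yp) last_rcons.
rewrite comb_dist_sym (comb_dist_par (ltnW r) pw) //; last by move=> E; rewrite E ltnn in r.
rewrite size_rcons comb_dist_sym; congr _.+1; apply: IHm.
- by rewrite size_rcons in le_m.
- by move: yp; rewrite rcons_path => /andP[].
- by move: up; rewrite -rcons_cons rcons_uniq => /andP[].
Qed.

(** The same induction on two paths at once: they have equal size by [comb_path_size], and both
    leave the end of larger rank through its parent. *)
Lemma comb_path_inj y p q : path comb_adj y p -> uniq (y :: p) ->
  path comb_adj y q -> uniq (y :: q) -> last y p = last y q -> p = q.
Proof.
have [m le_m] := ubnP (size p); elim: m y p q le_m => // m IHm y p q le_m yp up yq uq E.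
have E2 : size p = size q by rewrite !(@comb_path_size y) // E.
have [p0|pn] := eqVneq p [::].
  by apply/esym/eqP; rewrite p0 -size_eq0 -E2 p0.
have [r|r] := leqP (rk (last y p)) (rk y).
  case: p q pn le_m yp up r yq uq E E2 => // w p [|v q] // _ le_m yp up r yq uq E E2.
  have pw := comb_path_head yp up r.
  have := comb_path_head yq uq; rewrite -[last v q]E => /(_ r); rewrite pw => -[wv]; subst v.
  congr cons; apply: (IHm w) => //;
    by [case/andP: yp | case/andP: up | case/andP: yq | case/andP: uq].
case/lastP: p pn le_m yp up r E E2 => // p z _ le_m yp up; rewrite last_rcons => r.
case/lastP: q yq uq => [|q v] yq uq; first by rewrite size_rcons.
rewrite last_rcons !size_rcons => zv _; subst v.
have pw := comb_path_last yp up (ltnW r).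
have := comb_path_last yq uq (ltnW r); rewrite pw => -[wv].
congr rcons; apply: (IHm y) => //.
- by rewrite size_rcons in le_m.
- by move: yp; rewrite rcons_path => /andP[].
- by move: up; rewrite -rcons_cons rcons_uniq => /andP[].
- by move: yq; rewrite rcons_path => /andP[].
- by move: uq; rewrite -rcons_cons rcons_uniq => /andP[].
Qed.


(** * Cycles of a bouquet of combs *)

Section Bouquet.

Variable nb : pred coord.

(* [None] is the apex. *)
Definition bouquet_adj : rel (option coord) := fun v w =>
  match v, w with
  | Some v, Some w => comb_adj v w
  | Some v, None | None, Some v => nb v
  | None, None => false
  end.

Lemma exists_max (T : eqType) (r : T -> nat) (s : seq T) : s != [::] ->
  exists2 y, y \in s & {in s, forall z, r z <= r y}.
Proof.
case: s => // x s _; elim: s x => [|x' s IHs] x.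
  by exists x; rewrite ?mem_head // => z; rewrite inE => /eqP ->.
have [y ys ymax] := IHs x'.
have [le_xy|lt_yx] := leqP (r x) (r y).
  exists y; first by rewrite inE ys orbT.
  by move=> z; rewrite inE => /orP[/eqP -> //|/ymax].
exists x; rewrite ?mem_head // => z; rewrite inE => /orP[/eqP -> //|/ymax le_zy].
exact: leq_trans le_zy (ltnW lt_yx).
Qed.

(* Both neighbours of a vertex of maximal rank would be its parent. *)
Lemma comb_acyclic (s : seq coord) : 2 < size s -> uniq s -> ~~ cycle comb_adj s.
Proof.
move=> s2 us; apply/negP => cs.
have [|y ys ymax] := exists_max rk (s := s); first by case: s s2 us cs.
have [i p ip] := rot_to ys.
move: cs; rewrite -(rot_cycle i) ip.
have {}ymax z : z \in y :: p -> rk z <= rk y by rewrite -ip mem_rot => /ymax.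
have : uniq (y :: p) by rewrite -ip rot_uniq.
have : 2 < size (y :: p) by rewrite -ip size_rot.
case/lastP: p {ip} ymax => // p z; case: p => // w p ymax _ /= /and3P[_ wz _].
rewrite rcons_path last_rcons => /and3P[yw _ zy].
have pw : par y = Some w by apply: comb_adj_down yw _; apply: ymax; rewrite !inE eqxx orbT.
have pz : par y = Some z.
  apply: comb_adj_down; first by rewrite comb_adj_sym.
  by apply: ymax; rewrite !inE mem_rcons mem_head !orbT.
by move: wz; rewrite mem_rcons; move: pz; rewrite pw => -[->]; rewrite mem_head.
Qed.

Lemma notin_None_map_Some (s : seq (option coord)) :
  None \notin s -> exists q, s = map Some q.
Proof.
elim: s => [|[v|] s IHs] //; first by exists [::].
by rewrite inE /= => /IHs[q ->]; exists (v :: q).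
Qed.

Lemma bouquet_path (v : coord) (q : seq coord) :
  path bouquet_adj (Some v) (map Some q) = path comb_adj v q.
Proof. by elim: q v => //= w q IHq v; rewrite IHq. Qed.

(** The combs are acyclic, so a cycle visits the apex; reading it from there leaves a simple comb
    path between two distinct neighbours of the apex. *)
Lemma bouquet_cycle_form (s : seq (option coord)) : 2 < size s -> uniq s -> cycle bouquet_adj s ->
  exists i y q, [/\ rot i s = None :: map Some (y :: q), path comb_adj y q, uniq (y :: q),
    nb y & nb (last y q)] /\ y <> last y q.
Proof.
move=> s2 us cs.
have [xs|xs] := boolP (None \in s); last first.
  have [q sq] := notin_None_map_Some xs; subst s.
  have uq : uniq q by move: us; rewrite map_inj_uniq //; apply: Some_inj.
  rewrite size_map in s2.
  case/negP: (comb_acyclic s2 uq).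
  case: q cs {s2 us xs uq} => // y q /=.
  by rewrite -map_rcons bouquet_path.
have [i p ip] := rot_to xs; exists i; rewrite ip.
move: cs us s2; rewrite -(rot_cycle i) -(rot_uniq i) -(size_rot i) ip => cp up p2.
have [q pq] : exists q, p = map Some q by apply: notin_None_map_Some; case/andP: up.
subst p; case: q ip cp up p2 => // y q ip /= /andP[nby]; rewrite rcons_path bouquet_path.
case/andP=> yq nbz up p2; exists y, q.
have uq : uniq (y :: q).
  by rewrite -(map_inj_uniq (@Some_inj _)); case/andP: up.
rewrite (last_map Some) in nbz; split; first by [].
case: q uq {ip up yq nbz} p2 => // w q /= /andP[yw _] _ E.
by move: yw; rewrite {1}E mem_last.
Qed.

(** The cycle through the apex neighbours [y] and [z] has length [comb_dist y z + 2], so this asks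
    that a length determine the unordered pair. *)
Hypothesis dist_inj : forall y z y' z', nb y -> nb z -> nb y' -> nb z' ->
  y.1.1 = z.1.1 -> y'.1.1 = z'.1.1 -> y <> z -> y' <> z' ->
  comb_dist y z = comb_dist y' z' -> y' = y /\ z' = z \/ y' = z /\ z' = y.

Lemma bouquet_cycle_inj (s t : seq (option coord)) :
  2 < size s -> uniq s -> cycle bouquet_adj s -> uniq t -> cycle bouquet_adj t ->
  size s = size t -> exists i j k, rot i s = rot j t \/ rot i s = rot k (rev (rot j t)).
Proof.
move=> s2 us cs ut ct st.
have [i [y [q [[si yq uq nby nbz] yz]]]] := bouquet_cycle_form s2 us cs.
rewrite st in s2.
have [j [y' [q' [[tj yq' uq' nby' nbz'] yz']]]] := bouquet_cycle_form s2 ut ct.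
have sq : size q = size q'.
  have := f_equal size si; rewrite size_rot st -(size_rot j t) tj /= !size_map.
  by case.
have := dist_inj nby nbz nby' nbz' (comb_path_fan yq) (comb_path_fan yq') yz yz'.
rewrite -!comb_path_size // => /(_ sq) [] [Ey Ez].
  exists i, j, 0; left; rewrite si tj.
  by subst y'; rewrite (comb_path_inj yq uq yq' uq').
(* Reversal puts the apex last; rotating by [size t - 1], which is [rotr 1], brings it back to the
   front. *)
exists i, j, (size t - 1); right.
have -> : size t - 1 = size (rev (rot j t)) - 1 by rewrite size_rev size_rot.
rewrite -[RHS]/(rotr 1 _) tj rev_cons rotr1_rcons -map_rev si.
suff -> : y :: q = rev (y' :: q') by [].
have -> : rev (y' :: q') = y :: behead (rev (y' :: q')).
  rewrite -Ez; case/lastP: (q') => // r w.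
  by rewrite last_rcons -rcons_cons rev_rcons.
have E : y :: behead (rev (y' :: q')) = rev (y' :: q').
  rewrite -Ez; case/lastP: (q') => // r w.
  by rewrite last_rcons -rcons_cons rev_rcons.
congr cons; apply: (comb_path_inj (y := y)) => //.
- have := rev_path comb_adj y' q'.
  rewrite (_ : rev (belast y' q') = behead (rev (y' :: q'))); last first.
    by rewrite [in RHS](lastI y' q') rev_rcons.
  rewrite Ez => ->; rewrite (eq_path (e' := comb_adj)) // => v w.
  by rewrite comb_adj_sym.
- by rewrite E rev_uniq.
- by rewrite -[RHS]/(last y (y :: _)) E rev_cons last_rcons Ey.
Qed.

End Bouquet.

(** * Counting edges through an orientation *)

Lemma nedges_oriented (n : nat) (g : {ffun 'I_n * 'I_n -> bool}) (D : {set 'I_n * 'I_n}) :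
  (forall p, p \in D -> adj g p.1 p.2) ->
  (forall x y, (x, y) \in D -> (y, x) \notin D) -> #|D| <= nedges g.
Proof.
move=> Dg asymD; rewrite /nedges.
have injD : {in D &, injective (fun p : 'I_n * 'I_n => [set p.1; p.2])}.
  move=> [x y] [z w] /= xyD zwD E.
  have xE : x \in [set z; w] by rewrite -E !inE eqxx.
  have yE : y \in [set z; w] by rewrite -E !inE eqxx orbT.
  have zE : z \in [set x; y] by rewrite E !inE eqxx.
  have wE : w \in [set x; y] by rewrite E !inE eqxx orbT.
  move: xE yE zE wE xyD zwD; rewrite !inE.
  case/orP=> /eqP ->; case/orP=> /eqP -> // zE wE xyD zwD.
  - by move: wE; rewrite orbb => /eqP ->.
  - by case/negP: (asymD _ _ xyD).
  - by move: zE; rewrite orbb => /eqP ->.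
rewrite -(card_in_imset injD); apply/subset_leq_card/subsetP => E /imsetP[p pD ->].
rewrite inE; apply/existsP; exists p.1; apply/existsP; exists p.2.
by rewrite eqxx Dg.
Qed.

(** * Finite bouquets *)

Section Realization.

(* [G c] is the number of spine vertices of fan [c], with the positions and heights
   of the ends of its spokes other than the initial one, which starts at [(0, 0)]. *)
Variables (m : nat) (G : nat -> nat * seq (nat * nat)).

Definition spoke_ends (c : nat) : seq (nat * nat) := (0, 0) :: (G c).2.

Definition spoke (c i : nat) : coord :=
  (c, (nth (0, 0) (spoke_ends c) i).1, (nth (0, 0) (spoke_ends c) i).2).

Definition chord_end : pred coord := fun v =>
  (v.1.1 < m) && ((v.1.2, v.2) \in (G v.1.1).2).

(** The edges from vertices to parents and from roots to the apex form a spanning tree; every chord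
    end then adds one independent cycle. *)
Definition apex_nb : pred coord := fun v =>
  (par v == None) || chord_end v.

Definition fan_size (c : nat) : nat := (G c).1 + sumn (unzip2 (G c).2).

Definition fan_body (c : nat) : seq (nat * nat) :=
  [seq (a, 0) | a <- iota 0 (G c).1] ++ [seq (e.1, h) | e <- (G c).2, h <- iota 1 e.2].

Definition fan_coords : seq coord :=
  undup [seq (c, x.1, x.2) | c <- iota 0 m, x <- fan_body c].

Lemma size_fan_coords : size fan_coords <= \sum_(c < m) fan_size c.
Proof.
apply: leq_trans (size_undup _) _; rewrite size_allpairs_dep sumnE big_map.
rewrite -{1}[m]subn0 big_mkord; apply: leq_sum => c _.
rewrite size_cat size_map size_iota size_allpairs_dep leq_add2l.
by rewrite /unzip2; elim: (G c).2 => //= e s IHs; rewrite size_iota leq_add2l.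
Qed.

Lemma mem_fan_coords c a h :
  ((c, a, h) \in fan_coords) = (c < m) && ((a, h) \in fan_body c).
Proof.
rewrite mem_undup; apply/allpairsPdep/andP => [[c' [x [+ xb [-> -> ->]]]]|[cm ab]].
  by rewrite mem_iota -surjective_pairing.
by exists c, (a, h); rewrite mem_iota.
Qed.

Lemma mem_fan_body c a h : ((a, h) \in fan_body c) =
  ((a < (G c).1) && (h == 0)) || has (fun e => (e.1 == a) && (0 < h <= e.2)) (G c).2.
Proof.
rewrite mem_cat; congr (_ || _).
  apply/mapP/andP => [[a' + [-> ->]]|[am /eqP ->]]; first by rewrite mem_iota.
  by exists a; rewrite ?mem_iota.
apply/allpairsPdep/hasP => [[e [h' [eG + [-> ->]]]]|[e eG /andP[/eqP <- hh]]].
  by rewrite mem_iota => hh; exists e => //; rewrite eqxx /=; lia.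
by exists e, h; rewrite mem_iota; split => //; lia.
Qed.

Hypothesis ends_in_spine : forall c e, c < m -> e \in (G c).2 -> 0 < e.1 < (G c).1.
Hypothesis ends_uniq : forall c, c < m -> uniq (G c).2.
Hypothesis spoke_dist_inj : forall c c' i j i' j', c < m -> c' < m ->
  i < j < size (spoke_ends c) -> i' < j' < size (spoke_ends c') ->
  comb_dist (spoke c i) (spoke c j) = comb_dist (spoke c' i') (spoke c' j') ->
  [/\ c = c', i = i' & j = j'].

Lemma fan_coords_par v w : v \in fan_coords -> par v = Some w -> w \in fan_coords.
Proof.
case: v w => [[c a] h] [[c' a'] h']; rewrite !mem_fan_coords !mem_fan_body.
case/andP=> cm; case: h => [|h] /=.
  case: a => [|a] //= /orP[/andP[am _] [<- <- <-]|]; first by rewrite cm /= (ltnW am).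
  by case/hasP => e _; rewrite andbF.
case/orP=> [/andP[_ //]|/hasP[e eG /andP[ea eh]]] [<- <- <-]; rewrite cm /=.
case: h eh => [|h] eh.
  by case/andP: (ends_in_spine cm eG); rewrite (eqP ea) => _ ->.
by apply/orP; right; apply/hasP; exists e; rewrite // ea /=; lia.
Qed.

Lemma chord_end_coord v : chord_end v -> v \in fan_coords.
Proof.
case: v => [[c a] h] /andP[/= cm eG]; rewrite mem_fan_coords cm mem_fan_body /=.
case: h eG => [|h] eG; first by case/andP: (ends_in_spine cm eG) => _ /= ->.
by apply/orP; right; apply/hasP; exists (a, h.+1); rewrite //= eqxx leqnn.
Qed.

Lemma chord_end_par v : chord_end v -> par v != None.
Proof.
by case: v => [[c [|a]] [|h]] /andP[/= cm /(ends_in_spine cm)].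
Qed.

Lemma apex_nb_spoke v : v.1.1 < m -> apex_nb v ->
  exists2 i, i < size (spoke_ends v.1.1) & v = spoke v.1.1 i.
Proof.
case: v => [[c a] h] /= cm /orP[|/andP[_ eG]].
  by case: h => [|h] //; case: a => [|a] // _; exists 0.
exists (index (a, h) (G c).2).+1; first by rewrite /= ltnS index_mem.
by rewrite /spoke /= nth_index.
Qed.

Lemma apex_nb_inj y z y' z' : apex_nb y -> apex_nb z -> apex_nb y' -> apex_nb z' ->
  y.1.1 = z.1.1 -> y'.1.1 = z'.1.1 -> y <> z -> y' <> z' ->
  comb_dist y z = comb_dist y' z' -> y' = y /\ z' = z \/ y' = z /\ z' = y.
Proof.
(* From index [m] on, the root is the only apex neighbour of a fan, so two distinct ones force an
   index below [m]. *)
have lt_m u v : apex_nb u -> apex_nb v -> u.1.1 = v.1.1 -> u <> v -> u.1.1 < m.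
  case: u v => [[c a] h] [[c' a'] h'] + + /= E; rewrite -E.
  case/orP=> [|/andP[] //]; case: h => [|h] //; case: a => [|a] // _.
  by case/orP=> [|/andP[] //]; case: h' => [|h'] //; case: a' => [|a'].
move=> ny nz ny' nz' yz yz' dyz dyz' E.
have cm := lt_m _ _ ny nz yz dyz; have cm' := lt_m _ _ ny' nz' yz' dyz'.
have cz : z.1.1 < m by rewrite -yz.
have cz' : z'.1.1 < m by rewrite -yz'.
have [i ilt Ey] := apex_nb_spoke cm ny; have [j jlt Ez] := apex_nb_spoke cz nz.
have [i' ilt' Ey'] := apex_nb_spoke cm' ny'; have [j' jlt' Ez'] := apex_nb_spoke cz' nz'.
move: Ey Ez Ey' Ez' dyz dyz' E ilt jlt ilt' jlt'; rewrite -yz -yz'.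
move: (y.1.1) (y'.1.1) cm cm' => c c' cm cm' -> -> -> -> dyz dyz' E ilt jlt ilt' jlt'.
have ij : i <> j by move=> ij; apply: dyz; rewrite ij.
have ij' : i' <> j' by move=> ij'; apply: dyz'; rewrite ij'.
have [lij|lij] : i < j \/ j < i by lia.
all: have [lij'|lij'] : i' < j' \/ j' < i' by lia.
- by left; have [||-> -> ->] := spoke_dist_inj cm cm' _ _ E; rewrite ?lij ?lij'.
- rewrite [RHS]comb_dist_sym in E.
  by right; have [||-> -> ->] := spoke_dist_inj cm cm' _ _ E; rewrite ?lij ?lij'.
- rewrite comb_dist_sym in E.
  by right; have [||-> -> ->] := spoke_dist_inj cm cm' _ _ E; rewrite ?lij ?lij'.
- rewrite comb_dist_sym [RHS]comb_dist_sym in E.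
  by left; have [||-> -> ->] := spoke_dist_inj cm cm' _ _ E; rewrite ?lij ?lij'.
Qed.

Lemma count_chord_end : \sum_(c < m) size (G c).2 <= count chord_end fan_coords.
Proof.
set s := [seq (c, e.1, e.2) | c <- iota 0 m, e <- (G c).2].
have <- : size s = \sum_(c < m) size (G c).2.
  by rewrite size_allpairs_dep sumnE big_map -{1}[m]subn0 big_mkord.
rewrite -size_filter; apply: uniq_leq_size.
  apply: allpairs_uniq_dep; first exact: iota_uniq.
    by move=> c; rewrite mem_iota add0n => cm; apply: ends_uniq.
  by move=> [c [a h]] [c' [a' h']] _ _ /= [-> -> ->].
move=> v /allpairsPdep[c [e [+ eG ->]]]; rewrite mem_iota add0n => /= cm.
rewrite mem_filter.
have ce : chord_end (c, e.1, e.2) by rewrite /chord_end /= cm -surjective_pairing.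
by rewrite ce chord_end_coord.
Qed.

(** * Transfer to a graph on ordinals, the apex being vertex 0 *)

Section Numbering.

Variable cs : seq coord.
Hypotheses (cs_uniq : uniq cs)
  (cs_par : forall v w, v \in cs -> par v = Some w -> w \in cs).

Let S : seq (option coord) := None :: map Some cs.
Let N := (size cs).+1.
Let crd (x : 'I_N) : option coord := nth None S x.
Let g : {ffun 'I_N * 'I_N -> bool} :=
  [ffun p => bouquet_adj apex_nb (crd p.1) (crd p.2)].

Let sizeS : size S = N. Proof. by rewrite /= size_map. Qed.

Let uniqS : uniq S.
Proof.
rewrite /= map_inj_uniq ?cs_uniq ?andbT; last exact: Some_inj.
by apply/mapP => -[].
Qed.

Let crd_inj : injective crd.
Proof.
move=> x y /eqP; rewrite nth_uniq ?sizeS ?ltn_ord // => /eqP.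
exact: val_inj.
Qed.

Let adj_g x y : adj g x y = bouquet_adj apex_nb (crd x) (crd y).
Proof. by rewrite /adj ffunE. Qed.

Let g_admissible : admissible g.
Proof.
apply/andP; split.
  apply/andP; split; apply/forallP => x; last apply/forallP => y.
    rewrite adj_g; case: (crd x) => //= v; rewrite /comb_adj orbb.
    by apply/eqP => /par_rk/n_Sn.
  rewrite !adj_g; apply/eqP; case: (crd x) (crd y) => [v|] [w|] //=.
  exact: comb_adj_sym.
apply/forallP => k; apply/forallP => s; apply/forallP => t.
apply/implyP => /andP[/and3P[s2 us cs'] /and3P[_ ut ct]].
have cycle_crd r : cycle (adj g) r = cycle (bouquet_adj apex_nb) (map crd r).
  by rewrite cycle_map; apply: eq_cycle => x y; rewrite adj_g.
have [] := @bouquet_cycle_inj apex_nb apex_nb_inj (map crd s) (map crd t).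
- by rewrite size_map.
- by rewrite map_inj_uniq.
- by rewrite -cycle_crd.
- by rewrite map_inj_uniq.
- by rewrite -cycle_crd.
- by rewrite !size_map !size_tuple.
move=> i [j [l]]; rewrite -!map_rot -map_rev -map_rot => E; apply/eqP.
rewrite -(cycle_edges_rot i s); case: E => /(inj_map crd_inj) ->.
  exact: cycle_edges_rot.
by rewrite cycle_edges_rot cycle_edges_rev cycle_edges_rot.
Qed.

(** The edges oriented towards the apex. At a root [par v] is [None], which is also the apex, so the
    first disjunct covers the edges from roots to the apex. *)
Let D : {set 'I_N * 'I_N} := [set p | if crd p.1 is Some v then
  (crd p.2 == par v) || (crd p.2 == None) && chord_end v else false].

Let out_degree x v : crd x = Some v ->
  1 + chord_end v <= \sum_(y | (x, y) \in D) 1.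
Proof.
move=> xv; rewrite sum1dep_card.
have vcs : v \in cs.
  have : Some v \in S by rewrite -xv mem_nth // sizeS.
  by rewrite inE /= mem_map //; apply: Some_inj.
have [y yE] : exists y, crd y = par v.
  have pS : par v \in S.
    case pv: (par v) => [w|]; last by rewrite mem_head.
    by rewrite inE /= mem_map; [apply: cs_par pv | apply: Some_inj].
  have lt : index (par v) S < N by rewrite -sizeS index_mem.
  by exists (Ordinal lt); rewrite /crd nth_index.
have [ce|_] := boolP (chord_end v); last first.
  rewrite addn0 -(cards1 y); apply/subset_leq_card/subsetP => z.
  by rewrite !inE => /eqP ->; rewrite /= xv yE eqxx.
(* A chord end is not a root, so its edges to its parent and to the apex are different. *)
have y0 : y != ord0.
  by apply/eqP => y0; move: (chord_end_par ce); rewrite -yE y0.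
have -> : 1 + true = #|[set y; ord0]| by rewrite cards2 y0.
apply/subset_leq_card/subsetP => z.
by rewrite !inE /= xv => /orP[] /eqP -> /=; rewrite ?yE ?eqxx ?ce ?orbT.
Qed.

Let leq_card_D : size cs + count chord_end cs <= #|D|.
Proof.
rewrite -sum1_card (eq_bigl (fun p => (p.1, p.2) \in D)); last by case.
rewrite -(pair_big_dep xpredT (fun x y => (x, y) \in D) (fun _ _ => 1)) /=.
pose F (v : option coord) := if v is Some v then 1 + chord_end v else 0.
apply: (@leq_trans (\sum_(x < N) F (crd x))); last first.
  apply: leq_sum => x _; case xv: (crd x) => [v|] //=; exact: out_degree xv.
rewrite /crd -sizeS -(big_mkord xpredT (fun i => F (nth None S i))) -(big_nth None xpredT F).
rewrite big_cons big_map /= big_split /= sum1_size leq_add2l -sum1_count big_mkcond.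
by apply: leq_sum => v _; case: chord_end.
Qed.

Lemma numbered_lower_bound : size cs + count chord_end cs <= f (size cs).+1.
Proof.
apply: leq_trans leq_card_D _.
apply: (@leq_trans (nedges g)); last first.
  exact: (leq_bigmax_cond (F := fun g => nedges g)) g_admissible.
apply: nedges_oriented => [[x y]|x y]; rewrite inE /=.
  rewrite adj_g; case: (crd x) => [v|] //= /orP[/eqP ->|/andP[/eqP -> ce]].
    by case pv: (par v) => [w|]; rewrite /= /comb_adj /apex_nb pv eqxx.
  by rewrite /= /apex_nb ce orbT.
rewrite inE /=; case: (crd x) => [v|] //; case: (crd y) => [w|] //.
rewrite !andFb !orbF => /eqP vw; apply/eqP => wv.
by have := par_rk (esym vw); rewrite (par_rk (esym wv)); lia.
Qed.

End Numbering.

Theorem bouquet_lower_bound (n : nat) : \sum_(c < m) fan_size c < n ->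
  n - 1 + \sum_(c < m) size (G c).2 <= f n.
Proof.
move=> ltn.
have le_size := size_fan_coords.
(* Surplus vertices become roots of fans with index at least [m]: each hangs from the apex by one
   edge and creates no cycle. *)
pose pads : seq coord := [seq (m + i, 0, 0) | i <- iota 0 (n - 1 - size fan_coords)].
have pads_out v : v \in pads -> v \notin fan_coords /\ par v = None.
  case/mapP => i _ ->; split=> //; rewrite mem_fan_coords.
  by rewrite ltnNge leq_addr.
have ucs : uniq (fan_coords ++ pads).
  rewrite cat_uniq undup_uniq map_inj_uniq ?iota_uniq ?andbT /=.
    by apply/hasPn => v /pads_out[].
  by move=> i j [] /addnI.
have par_cs v w : v \in fan_coords ++ pads -> par v = Some w -> w \in fan_coords ++ pads.
  rewrite !mem_cat => /orP[vf /(fan_coords_par vf) -> //|/pads_out[_ ->] //].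
have := numbered_lower_bound ucs par_cs.
have size_cs : size (fan_coords ++ pads) = n - 1.
  by rewrite size_cat size_map size_iota; lia.
rewrite size_cs subn1 prednK; last by lia.
apply: leq_trans; rewrite leq_add2l count_cat.
exact: leq_trans count_chord_end (leq_addr _ _).
Qed.

End Realization.

(** * The ten-spoke fans *)

(* Found by computer search: the cycle through spokes [i < j] of fan [c] has length
   [2 tau (right_slot j - left_slot i) + 2 c + 2 + shift j - shift i]. *)
Definition left_slot (i : nat) : nat := nth 0 [:: 3; 11; 19; 27; 37; 47; 55; 61; 71] i.
Definition right_slot (j : nat) : nat := nth 0 [:: 0; 18; 29; 39; 45; 57; 69; 71; 83; 85] j.
Definition shift (i : nat) : nat := nth 0 [:: 0; 1; 1; 0; 1; 1; 0; 0; 0; 0] i.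

Lemma shift_le1 i : shift i <= 1.
Proof. by do 10! [case: i => [|i] //]; rewrite /shift nth_default. Qed.

Definition spoke_pairs := [seq (i, j) | i <- iota 0 10, j <- [seq j <- iota 0 10 | i < j]].

Lemma mem_spoke_pairs i j : ((i, j) \in spoke_pairs) = (i < j < 10).
Proof.
apply/allpairsPdep/andP => [[i' [j' [+ + [-> ->]]]]|[ij j10]].
  by rewrite mem_filter !mem_iota => _ /andP[-> /=].
by exists i, j; rewrite mem_filter ij !mem_iota /=; split=> //; lia.
Qed.

Lemma left_lt_right_slot i j : i < j < 10 -> left_slot i < right_slot j.
Proof.
have /allP H : all (fun x => left_slot x.1 < right_slot x.2) spoke_pairs by vm_compute.
by rewrite -mem_spoke_pairs => /H.
Qed.

(** Same pair, lengths of opposite parity, or slot differences at least 2 apart; the last is written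
    with terms moved across to avoid truncated subtraction. *)
Definition separated (i j i' j' : nat) : bool :=
  [|| (i == i') && (j == j'), odd (shift i + shift j + shift i' + shift j'),
      right_slot j + left_slot i' + 2 <= right_slot j' + left_slot i
    | right_slot j' + left_slot i + 2 <= right_slot j + left_slot i'].

Lemma slots_separated i j i' j' : i < j < 10 -> i' < j' < 10 -> separated i j i' j'.
Proof.
have /allP H : all (fun x => all (fun y => separated x.1 x.2 y.1 y.2) spoke_pairs) spoke_pairs.
  by vm_compute.
by rewrite -!mem_spoke_pairs => /H /allP; apply.
Qed.

(** A window spans two slots, so the bound 22 keeps consecutive spokes below slot 24, where by
    [nonadjacent_slots] all other windows start. *)
Lemma adjacent_slots i : i < 9 -> 14 <= right_slot i.+1 - left_slot i <= 22.
Proof. by do 9! [case: i => [|i] //]. Qed.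

Lemma nonadjacent_slots i j : i.+1 < j < 10 -> 24 <= right_slot j - left_slot i.
Proof.
have /allP H : all (fun x => (x.1.+1 < x.2) ==> (24 <= right_slot x.2 - left_slot x.1)) spoke_pairs.
  by vm_compute.
case/andP=> ij j10; have /H : (i, j) \in spoke_pairs by rewrite mem_spoke_pairs; lia.
by rewrite ij.
Qed.

Definition fan_length (tau c i j : nat) : nat :=
  2 * tau * (right_slot j - left_slot i) + 2 * c + 2 + shift j - shift i.

(** As [c <= 2 * tau - 2] and shifts are at most 1, the offset [2 * c + 2 + shift j - shift i] lies
    strictly between 0 and [4 * tau], the width of two slots. *)
Lemma fan_length_inj tau c c' i j i' j' : c.+1 < 2 * tau -> c'.+1 < 2 * tau ->
  i < j < 10 -> i' < j' < 10 ->
  fan_length tau c i j = fan_length tau c' i' j' -> [/\ c = c', i = i' & j = j'].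
Proof.
move=> cF cF' ij ij' E.
have Xi := left_lt_right_slot ij; have Xi' := left_lt_right_slot ij'.
have pi := shift_le1 i; have pj := shift_le1 j.
have pi' := shift_le1 i'; have pj' := shift_le1 j'.
have {}E : tau * (2 * (right_slot j + left_slot i')) + 2 * c + shift j + shift i' =
           tau * (2 * (right_slot j' + left_slot i)) + 2 * c' + shift j' + shift i.
  move: E; rewrite /fan_length -(subnK (ltnW Xi)) -(subnK (ltnW Xi')) !addnK; nia.
case/or4P: (slots_separated ij ij') => [/andP[/eqP ii /eqP jj]|par|far|far].
- by subst i' j'; split=> //; lia.
- by move: E; rewrite !(mulnCA tau 2); lia.
- have := leq_mul (leqnn tau) (leq_mul (leqnn 2) far).
  rewrite mulnDr mulnDr; lia.
- have := leq_mul (leqnn tau) (leq_mul (leqnn 2) far).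
  rewrite mulnDr mulnDr; lia.
Qed.

(* The constant [6] is [2 * left_slot 0]: positions are measured from the end of spoke 0. *)
Definition fan_ends (tau c : nat) : seq (nat * nat) :=
  rcons [seq ((right_slot j + left_slot j - 6) * tau + c + shift j,
              (right_slot j - left_slot j) * tau + c) | j <- iota 1 8]
    (164 * tau + 2 * c, 0).

(** Positions carry the sum of the two slots and heights their difference, so [left_slot j] and
    [right_slot i] cancel along tooth, spine, tooth. The last spoke ends on the spine, at
    [164 = 2 * (85 - 3)] times [tau], plus [2 * c]. The added 2 counts the edges at the apex. *)
Lemma dist_fan_ends tau c i j : 0 < tau -> i < j < 10 ->
  let e := (0, 0) :: fan_ends tau c in
  comb_dist (c, (nth (0, 0) e i).1, (nth (0, 0) e i).2)
            (c, (nth (0, 0) e j).1, (nth (0, 0) e j).2) + 2 = fan_length tau c i j.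
Proof.
move=> tau0 ij e; move: ij.
do 10! [case: j => [|j]; first by
  do 10! [case: i => [|i]; first by
    rewrite /fan_length /=; try case: eqP; rewrite /left_slot /right_slot /shift /=; lia]].
by rewrite !ltnS ltn0 andbF.
Qed.

(** * The extremal graph *)

Section Construction.

Variable tau : nat.
Hypothesis tau_gt0 : 0 < tau.

Local Notation nfans := (2 * tau).-1.

Definition adjacent_lengths : seq nat :=
  [seq fan_length tau c i i.+1 | c <- iota 0 nfans, i <- iota 0 9].

Definition single_lengths : seq nat :=
  [seq l <- iota 3 (48 * tau - 3) | l \notin adjacent_lengths].

(** Past the fans, a block is a path of [l - 1] vertices with both ends joined to the apex, hence a
    single cycle of length [l]. *)
Definition blocks (c : nat) : nat * seq (nat * nat) :=
  if c < nfans then (164 * tau + 2 * c + 1, fan_ends tau c)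
  else let l := nth 3 single_lengths (c - nfans) in (l - 1, [:: (l - 2, 0)]).

Local Notation m := (nfans + size single_lengths).

Lemma uniq_adjacent_lengths : uniq adjacent_lengths.
Proof.
apply: allpairs_uniq; rewrite ?iota_uniq // => -[c i] [c' i'].
move=> /allpairsPdep[c0 [i0 [+ + [-> ->]]]]; rewrite !mem_iota => cF iF.
move=> /allpairsPdep[c1 [i1 [+ + [-> ->]]]]; rewrite !mem_iota => cF' iF' E.
by have [||||-> -> _] := fan_length_inj _ _ _ _ E; rewrite //; lia.
Qed.

Lemma adjacent_lengths_bounds l : l \in adjacent_lengths -> 3 <= l < 48 * tau.
Proof.
case/allpairsPdep=> c [i [+ + ->]]; rewrite !mem_iota => cF iF.
have i9 : i < 9 by lia.
have /andP[lo hi] := adjacent_slots i9.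
have p := shift_le1 i; have p' := shift_le1 i.+1.
rewrite /fan_length; move: (right_slot i.+1 - left_slot i) lo hi => w lo hi.
have := leq_mul (leqnn (2 * tau)) lo; have := leq_mul (leqnn (2 * tau)) hi.
lia.
Qed.

Lemma perm_adjacent_single : perm_eq (single_lengths ++ adjacent_lengths) (iota 3 (48 * tau - 3)).
Proof.
apply: uniq_perm; rewrite ?iota_uniq //.
  rewrite cat_uniq filter_uniq ?iota_uniq // uniq_adjacent_lengths andbT /=.
  by apply/hasPn => l la; rewrite mem_filter la.
move=> l; rewrite mem_cat mem_filter.
have [la|] := boolP (l \in adjacent_lengths); last by rewrite orbF.
by have := adjacent_lengths_bounds la; rewrite mem_iota; lia.
Qed.

Lemma size_single_lengths : size single_lengths + 9 * nfans = 48 * tau - 3.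
Proof.
have := perm_size perm_adjacent_single.
by rewrite size_cat size_allpairs !size_iota [9 * _]mulnC.
Qed.

Lemma mem_single_lengths l : l \in single_lengths -> 3 <= l < 48 * tau.
Proof. by rewrite mem_filter mem_iota => /andP[_]; lia. Qed.

(** * Numbers of vertices and of chords *)

Lemma sum_linear k a b :
  2 * \sum_(c < k) (a * c + b) + a * k = a * (k * k) + 2 * b * k.
Proof.
elim: k => [|k IHk]; first by rewrite big_ord0 !muln0.
by rewrite big_ord_recr /= -/(\sum_(c < k) (a * c + b)); move: (\sum_(c < k) _) IHk => s IHk; nia.
Qed.

(** A separate cycle of length [l] costs [l - 1] vertices besides the apex; this total is what the
    fans remove from the cost of single cycles. *)
Lemma sum_adjacent_lengths :
  \sum_(l <- adjacent_lengths) (l - 1) = \sum_(c < nfans) (18 * c + (330 * tau + 9)).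
Proof.
rewrite big_allpairs_dep -(big_mkord xpredT (fun c => 18 * c + (330 * tau + 9))) /index_iota subn0.
apply: eq_bigr => c _; rewrite !big_cons big_nil.
(* Here [w] is the slot difference and [d] is [1 + shift j - shift i]. The nine values of [w] sum to
   165, and those of [d] telescope to 9. *)
have E i j w d : right_slot j - left_slot i = w -> shift j + 1 = shift i + d ->
    fan_length tau c i j - 1 = 2 * tau * w + 2 * c + d.
  by rewrite /fan_length => ->; lia.
rewrite (E 0 1 15 2) // (E 1 2 18 1) // (E 2 3 20 0) // (E 3 4 18 2) // (E 4 5 20 1) //.
rewrite (E 5 6 22 0) // (E 6 7 16 1) // (E 7 8 22 1) // (E 8 9 14 1) //=; lia.
Qed.

Lemma sum_single_lengths :
  2 * \sum_(l <- single_lengths) (l - 1) + 2 * \sum_(c < nfans) (18 * c + (330 * tau + 9)) =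
  (48 * tau - 3) * (48 * tau).
Proof.
rewrite -sum_adjacent_lengths -mulnDr -big_cat (perm_big _ perm_adjacent_single) /=.
have : 3 <= 48 * tau by lia.
move: (48 * tau) => k; case: k => [|[|[|k]]] // _; rewrite subSS subSS subSS subn0.
elim: k => [|k IHk]; first by rewrite big_nil.
have -> : iota 3 k.+1 = iota 3 k ++ [:: 3 + k] by rewrite -[k.+1]addn1 iotaD.
by rewrite big_cat /= big_cons big_nil mulnDr IHk /=; nia.
Qed.

(** The eight inner teeth add [83 * tau + 8 * c] vertices to the [164 * tau + 2 * c + 1] of the
    spine. *)
Lemma fan_size_blocks c : c < nfans -> fan_size blocks c = 10 * c + (247 * tau + 1).
Proof.
by move=> cF; rewrite /fan_size /blocks cF /fan_ends /right_slot /left_slot /=; lia.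
Qed.

Lemma blocks_single i : i < size single_lengths ->
  let l := nth 3 single_lengths i in
  blocks (nfans + i) = (l - 1, [:: (l - 2, 0)]) /\ 3 <= l < 48 * tau.
Proof.
move=> ilt l; split; last by apply: mem_single_lengths; apply: mem_nth.
by rewrite /blocks ltnNge leq_addr addKn.
Qed.

Lemma sum_fan_size_blocks :
  \sum_(c < m) fan_size blocks c = 970 * tau ^ 2 + 19 * tau.
Proof.
rewrite big_split_ord /=.
rewrite (eq_bigr (fun c : 'I_nfans => 10 * c + (247 * tau + 1))); last first.
  by move=> c _; rewrite fan_size_blocks.
rewrite [X in _ + X](_ : _ = \sum_(l <- single_lengths) (l - 1)); last first.
  rewrite (big_nth 3) big_mkord; apply: eq_bigr => i _.
  rewrite /fan_size /=; have [E _] := blocks_single (ltn_ord i).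
  by rewrite E /= !addn0.
have := sum_single_lengths; have := sum_linear nfans 10 (247 * tau + 1).
have := sum_linear nfans 18 (330 * tau + 9).
move: (\sum_(c < _) _) (\sum_(c < _) _) (\sum_(l <- _) _) => s1 s2 s3.
case: tau tau_gt0 => // u _; rewrite mulnS; lia.
Qed.

(** Nine chords per fan and one per single cycle match the lengths from 3 to [48 * tau - 1] one to
    one. *)
Lemma sum_chords : \sum_(c < m) size (blocks c).2 = 48 * tau - 3.
Proof.
rewrite -size_single_lengths big_split_ord /= addnC; congr (_ + _).
  rewrite (eq_bigr (fun=> 1)) ?sum1_card ?card_ord // => i _.
  by have [-> _] := blocks_single (ltn_ord i).
rewrite (eq_bigr (fun=> 9)) ?sum_nat_const ?card_ord => [|c _]; first exact: mulnC.
by rewrite /= /blocks ltn_ord.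
Qed.

(** * Cycle lengths of the blocks *)

Lemma block_cases c : c < m -> c < nfans \/
  exists2 l, l \in single_lengths &
    [/\ blocks c = (l - 1, [:: (l - 2, 0)]), c = nfans + index l single_lengths
      & 3 <= l < 48 * tau].
Proof.
move=> cm; have [|le] := ltnP c nfans; [by left | right].
have lt : c - nfans < size single_lengths by lia.
have [E b] := blocks_single lt; exists (nth 3 single_lengths (c - nfans)); first exact: mem_nth.
by rewrite index_uniq ?filter_uniq ?iota_uniq // subnKC // -E subnKC.
Qed.

Lemma fan_ends_path c : path ltn 0 (unzip1 (fan_ends tau c)).
Proof. by rewrite /= /right_slot /left_slot /shift /=; lia. Qed.

Lemma ends_in_spine_blocks c e : c < m -> e \in (blocks c).2 -> 0 < e.1 < (blocks c).1.
Proof.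
case/block_cases => [cF|[l _ [-> _ l3]]]; last by rewrite inE => /eqP -> /=; lia.
rewrite /blocks cF => ee; have e1 : e.1 \in unzip1 (fan_ends tau c) by apply: map_f.
have := fan_ends_path c; have := fan_ends_path c.
rewrite {1}(path_sortedE ltn_trans) => /andP[/allP/(_ _ e1) -> _] p /=.
move: ee; rewrite mem_rcons inE => /orP[/eqP ->|/mapP[j + ->]] /=; first by lia.
rewrite mem_iota; case: j => [|[|[|[|[|[|[|[|[|j]]]]]]]]] // _.
all: by rewrite /right_slot /left_slot /shift /=; lia.
Qed.

Lemma ends_uniq_blocks c : c < m -> uniq (blocks c).2.
Proof.
case/block_cases => [cF|[l _ [-> _ _]]] //; rewrite /blocks cF.
apply: (@map_uniq _ _ fst); have := path_sorted (fan_ends_path c).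
exact: (sorted_uniq ltn_trans ltnn).
Qed.

Lemma dist_blocks c i j : c < m -> i < j < size (spoke_ends blocks c) ->
  [/\ c < nfans, j < 10 &
    comb_dist (spoke blocks c i) (spoke blocks c j) + 2 = fan_length tau c i j] \/
  (exists2 l, l \in single_lengths & [/\ i = 0, j = 1, c = nfans + index l single_lengths &
     comb_dist (spoke blocks c i) (spoke blocks c j) + 2 = l]).
Proof.
case/block_cases => [cF|[l ls [E Ec l3]]]; last first.
  rewrite /spoke_ends E /= => ij; have [-> ->] : i = 0 /\ j = 1 by lia.
  right; exists l => //; split=> //; rewrite /spoke /spoke_ends E /=.
  by case: eqP; lia.
rewrite /spoke /spoke_ends /blocks cF => ij; left; split=> //; first by case/andP: ij.
exact: dist_fan_ends.
Qed.

(** Lengths from consecutive spokes were filtered out of [single_lengths]; those of other pairs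
    exceed [48 * tau]. *)
Lemma single_fan_length c i j : c < nfans -> i < j < 10 ->
  fan_length tau c i j \notin single_lengths.
Proof.
move=> cF ij; rewrite mem_filter negb_and negbK.
have [<-|ji] := eqVneq i.+1 j.
  apply/orP; left; apply/allpairsPdep; exists c, i; rewrite !mem_iota; split=> //; lia.
have {}ij : i.+1 < j < 10 by lia.
have := leq_mul (leqnn (2 * tau)) (nonadjacent_slots ij).
have := shift_le1 i; rewrite mem_iota /fan_length; lia.
Qed.

Lemma spoke_dist_inj_blocks c c' i j i' j' : c < m -> c' < m ->
  i < j < size (spoke_ends blocks c) -> i' < j' < size (spoke_ends blocks c') ->
  comb_dist (spoke blocks c i) (spoke blocks c j) =
  comb_dist (spoke blocks c' i') (spoke blocks c' j') ->
  [/\ c = c', i = i' & j = j'].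
Proof.
move=> cm cm' ij ij' E.
case: (dist_blocks cm ij) => [[cF j10 L]|[l ls [i0 j0 Ec L]]];
  case: (dist_blocks cm' ij') => [[cF' j10' L']|[l' ls' [i0' j0' Ec' L']]].
- have {}ij : i < j < 10 by lia. have {}ij' : i' < j' < 10 by lia.
  apply: (@fan_length_inj tau) => //; [lia|lia|].
  by rewrite -L E.
- have {}ij : i < j < 10 by lia.
  by have := single_fan_length cF ij; rewrite -L E L' ls'.
- have {}ij' : i' < j' < 10 by lia.
  by have := single_fan_length cF' ij'; rewrite -L' -E L ls.
- have ll : l = l' by rewrite -L E L'.
  by rewrite i0 j0 Ec i0' j0' Ec' ll.
Qed.

Lemma fans_lower_bound n : 970 * tau ^ 2 + 19 * tau < n -> n - 1 + (48 * tau - 3) <= f n.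
Proof.
rewrite -sum_fan_size_blocks -sum_chords; apply: bouquet_lower_bound.
- exact: ends_in_spine_blocks.
- exact: ends_uniq_blocks.
- exact: spoke_dist_inj_blocks.
Qed.

End Construction.

(* n >= 6911/16 t^2 + 514441/8 t - 3309665/16, multiplied through by 16. *)
Theorem mainTheorem1 (r : nat) (hr : 1 <= r) (n : nat) :
  let t := 27720 * r + 169 in
  6911 * t ^ 2 + 1028882 * t <= 16 * n + 3309665 ->
  n + 32 * t - 1 <= f n.
Proof.
rewrite /= -mulnn => le_n.
(* This is [tau = (2 * t + 1) / 3], the least value with [48 * tau - 3 >= 32 * t]. Then
   [970 * tau ^ 2] is about [431.1 * t ^ 2], below the allowed [6911 / 16], about 431.9, times
   [t ^ 2]. *)
have tau_gt0 : 0 < 18480 * r + 113 by lia.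
apply: leq_trans (fans_lower_bound tau_gt0 _); rewrite -?mulnn.
(* [lia] does not read literals above 5000: unfold them in Horner form. *)
all: move: le_n; cbn [Nat.of_num_uint Nat.of_uint Nat.of_uint_acc].
all: rewrite !PeanoNat.Nat.tail_mul_spec.
all: lia.
Qed.
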